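(* For every integer $n\ge 1$ the remainder $(\mathbb{R}^n)^*$ maps continuously onto $\mathbb{H}^*$, and hence onto every continuum of weight $\aleph_1$.
   Context: A continuum is a (nonempty) compact connected Hausdorff space. The weight of a space is the least cardinality of a base for its topology. For a locally compact, noncompact Hausdorff space $X$, $X^*=\beta X\setminus X$ denotes its Čech–Stone remainder; $\mathbb{H}=[0,\infty)$ is the half line with its usual topology. *)

(* Defs.v *)
From HB Require Import structures.
From mathcomp Require Import all_boot all_order all_algebra.
From mathcomp Require Import all_classical all_reals all_analysis.
Import numFieldNormedType.Exports.

Set Implicit Arguments.
Unset Strict Implicit.
Unset Printing Implicit Defensive.

Import Order.TTheory GRing.Theory Num.Theory.

Local Open Scope classical_set_scope.
Local Open Scope card_scope.
Local Open Scope ring_scope.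

Section StoneCech.
Context (R : realType) (X : topologicalType).

Definition unit_itv : topologicalType := set_type (`[0, 1]%classic : set R).

(* The cube [0,1]^C(X,[0,1]), with the product topology. *)
Definition stone_cech_cube : topologicalType :=
  prod_topology (fun _ : continuousType X unit_itv => unit_itv).

Definition stone_cech_ev (x : X) : stone_cech_cube :=
  fun f : continuousType X unit_itv => f x.

(* Cech's construction: for X completely regular Hausdorff, stone_cech_ev is an
   embedding and the closure of its range is the Cech-Stone compactification
   of X. *)
Definition stone_cech : set stone_cech_cube := closure (range stone_cech_ev).

Definition stone_cech_remainder : topologicalType :=
  set_type (stone_cech `\` range stone_cech_ev).

End StoneCech.

(* set_type A is A itself with the induced topology, as opposed to subspace A,
   which lives on the ambient type and isolates the points outside A. *)
Definition half_line (R : realType) : topologicalType :=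
  set_type (`[0, +oo[%classic : set R).

Definition euclidean_space (R : realType) (n : nat) : topologicalType :=
  'rV[R]_n.

Definition maps_onto (S T : topologicalType) : Prop :=
  exists f : S -> T, continuous f /\ range f = [set: T].

Definition continuum (K : topologicalType) : Prop :=
  [/\ [set: K] !=set0, compact [set: K], connected [set: K] &
      hausdorff_space K].

(* A has the least uncountable cardinality. *)
Definition card_aleph1 (T : Type) (A : set T) : Prop :=
  ~ countable A /\
  forall (U : Type) (B : set U), ~ countable B -> A #<= B.

Definition weight_aleph1 (K : topologicalType) : Prop :=
  exists B : set (set K),
    [/\ basis B, forall B' : set (set K), basis B' -> B #<= B' &
        card_aleph1 B].

(* Main.v *)
From HB Require Import structures.
Require Import Defs.
From mathcomp Require Import all_boot all_order all_algebra.
From mathcomp Require Import all_classical all_reals all_analysis.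
From mathcomp Require Import wochoice lra.
Import Order.TTheory GRing.Theory Num.Theory numFieldNormedType.Exports.

(** The norm r on R^n is a proper map onto the half line H, so that it extends
    to a map of (R^n)* onto H*; and a path f from H into a cube [0,1]^I, composed
    with r and extended to the remainder, has as image the cluster set of f at
    infinity ([remainder_values]). Given a continuum K of weight aleph_1,
    embedded in [0,1]^I by Urysohn functions psi i indexed by pairs of members
    of a base, it is therefore enough to find a continuous path whose cluster
    set at infinity is exactly K.

    Let a base point of K be moved to the origin of R^I. For finitely many
    coordinates s and a positive eps there is a loop in R^I at the origin that,
    in the coordinates s, stays within eps of K and comes within eps of every
    point of K: since K is connected, a finite net of K is visited by a closed
    walk with small steps, which is interpolated linearly ([traces_nonempty]). What is needed is a sequence of loops y_n such that for
    every s and every eps this holds for all but finitely many n; the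
    concatenation of the y_n is then the required path. As there are
    uncountably many s, diagonalization does not suffice.

    The coordinates of the sequence are found in countable blocks, by recursion
    along a well-order in which every initial segment is countable
    ([frechet_power_saturation]). The danger is that the coordinates chosen so
    far cannot be completed to tuples of loops that trace K. The remedy is to
    carry along, for every finite list of conditions that hold for all good
    enough approximating loops, that the coordinates chosen so far extend to a
    solution of the list for almost all n. Conditions are expressed by finite
    sets of rational points and rational radii, without reference to K. Hence
    over countably many chosen coordinates there are only countably many lists
    up to renaming the other coordinates, and a diagonal choice of the next
    coordinates keeps the hypothesis ([extend_stage]). This is the
    aleph_1-saturation of a reduced power modulo the Frechet filter, restricted
    to positive primitive formulas. *)

Set Implicit Arguments.
Unset Strict Implicit.
Unset Printing Implicit Defensive.
Local Open Scope classical_set_scope.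

(** * Saturation of Frechet powers *)

Section FrechetPower.
Context (I : choiceType) (A : Type) (C : countType) (D : C -> seq A -> Prop).

(** A pair (c, s) is the condition that the tuple of the s-coordinates of a
    point of I -> A satisfies D c. Only the finitely many coordinates
    listed in s matter, and this is what makes the recursion below pass
    through limit stages. *)
Definition satisfies (l : seq (C * seq I)) (y : I -> A) : Prop :=
  forall cs, cs \in l -> D cs.1 (map y cs.2).

Lemma satisfies_cat l1 l2 :
  satisfies (l1 ++ l2) = satisfies l1 `&` satisfies l2.
Proof.
apply/seteqP; split => [y h|y [h1 h2] cs].
  by split=> cs hcs; apply: h; rewrite mem_cat hcs ?orbT.
by rewrite mem_cat => /orP[]; [exact: h1|exact: h2].
Qed.

Lemma eq_satisfies l (y y' : I -> A) :
  (forall i, i \in flatten (map snd l) -> y i = y' i) ->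
  satisfies l y -> satisfies l y'.
Proof.
move=> yy' h cs hcs; suff <- : map y cs.2 = map y' cs.2 by exact: h.
apply/eq_in_map => i hi; apply: yy'.
by apply/flattenP; exists cs.2 => //; apply: map_f.
Qed.

(** Over a countable set S of coordinates there are only countably many
    conditions up to renaming the coordinates outside S: the pattern of a list
    keeps the coordinates in S, numbered by e, and replaces every other
    coordinate by the place where it first occurs in the list. *)
Section Pattern.
Context (S : set I) (e : I -> nat) (e_inj : {in S &, injective e}).

Definition pattern_code (l : seq (C * seq I)) i : nat + nat :=
  if i \in S then inl (e i) else inr (index i (flatten (map snd l))).

Definition pattern (l : seq (C * seq I)) : seq (C * seq (nat + nat)) :=
  map (fun cs => (cs.1, map (pattern_code l) cs.2)) l.

(** Two lists with the same pattern impose the same constraint on the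
    coordinates in S: a point that solves one list is turned into a solution of
    the other by renaming its coordinates outside S. *)
Lemma same_pattern l l' (x : I -> A) : pattern l = pattern l' ->
  satisfies l' x ->
  exists y, (forall i, S i -> y i = x i) /\ satisfies l y.
Proof.
move=> pE l'x.
(* The default value x i of nth is never read. *)
pose y i := if i \in S then x i else
  nth (x i) (map x (flatten (map snd l'))) (index i (flatten (map snd l))).
exists y; split; first by move=> i Si; rewrite /y mem_set.
move=> cs csl.
have : (cs.1, map (pattern_code l) cs.2) \in pattern l'.
  by rewrite -pE; apply/mapP; exists cs.
case/mapP => cs' csl' [c_eq s_eq].
rewrite c_eq; suff -> : map y cs.2 = map x cs'.2 by exact: l'x.
have szE : size cs.2 = size cs'.2.
  by move: (congr1 size s_eq); rewrite !size_map.
have [s0|[i0 s_ne]] : cs.2 = [::] \/ exists i, i \in cs.2.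
- by case: (cs.2) => [|i s]; [left|right; exists i; rewrite inE eqxx].
- by move: szE; rewrite s0; case: (cs'.2).
apply: (@eq_from_nth _ (x i0)); rewrite !size_map // => k kl.
have kl' : (k < size cs'.2)%N by rewrite -szE.
rewrite (nth_map i0) // (nth_map i0) //.
have := congr1 (nth (inl 0) ^~ k) s_eq.
rewrite (nth_map i0) // (nth_map i0) //.
have : nth i0 cs'.2 k \in flatten (map snd l').
  by apply/flattenP; exists cs'.2; [exact: map_f|exact: mem_nth].
rewrite /pattern_code /y.
case: ifPn => inS; case: ifPn => inS' //.
  by move=> _ [/e_inj ->].
move=> mem [->]; rewrite (nth_map i0) ?index_mem // nth_index //.
Qed.

End Pattern.

(** One stage of the construction. T is the set of finite lists of conditions
    to be met in the limit, and the sequence cur, of which only the coordinates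
    in S are relevant, can be completed to a solution of any list of T, for
    almost all n. By countability of S', a sequence r of lists of T represents
    all patterns; the n-th term of the extended sequence is a solution of as
    long an initial segment of r as can be solved given cur n. *)
Lemma extend_stage (T : set (seq (C * seq I))) (S S' : set I)
    (cur : nat -> I -> A) :
  T [::] -> (forall l l', T l -> T l' -> T (l ++ l')) ->
  S `<=` S' -> countable S' ->
  (forall l, T l -> \forall n \near \oo,
     exists y, (forall i, S i -> y i = cur n i) /\ satisfies l y) ->
  exists x : nat -> I -> A, (forall n i, S i -> x n i = cur n i) /\
    forall l, T l -> \forall n \near \oo,
      exists y, (forall i, S' i -> y i = x n i) /\ satisfies l y.
Proof.
move=> T0 Tcat SS' /countable_injP[e e_inj] Tcur.
have /choice[r rP] : forall k : nat, exists l', T l' /\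
    forall l, T l -> unpickle k = Some (pattern S' e l) ->
      pattern S' e l = pattern S' e l'.
  move=> k; have [[l [Tl lk]]|no] :=
      pselect (exists l, T l /\ unpickle k = Some (pattern S' e l)).
    by exists l; split => // l' _; rewrite lk => -[->].
  by exists [::]; split => // l Tl lk; exfalso; apply: no; exists l.
pose L k := flatten (map r (iota 0 k)).
have TL k : T (L k).
  rewrite /L; elim: (iota 0 k) => //= j s IH.
  by apply: Tcat => //; case: (rP j).
have Lle k k' y : (k <= k')%N -> satisfies (L k') y -> satisfies (L k) y.
  move=> kk'; rewrite /L -(subnKC kk') iotaD map_cat flatten_cat satisfies_cat.
  by case.
have Lr k y : satisfies (L k.+1) y -> satisfies (r k) y.
  rewrite /L -addn1 iotaD map_cat flatten_cat satisfies_cat /= cats0.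
  by case.
have /choice[x xP] : forall n, exists y,
    (forall i, S i -> y i = cur n i) /\
    forall k, (k <= n)%N ->
      (exists y', (forall i, S i -> y' i = cur n i) /\ satisfies (L k) y') ->
      satisfies (L k) y.
  move=> n.
    (* Capping the length at n makes the longest solvable segment exist. *)
pose P k := (k <= n)%N && `[< exists y', (forall i, S i -> y' i = cur n i) /\
    satisfies (L k) y' >].
  have exP : exists k, P k.
    by exists 0; apply/andP; split => //; apply/asboolP; exists (cur n); split.
  have leP k : P k -> (k <= n)%N by case/andP.
  case: (ex_maxnP exP leP) => m /andP[mn /asboolP[y [yS yL]]] mmax.
  exists y; split=> // k kn ky; apply: Lle yL; apply: mmax.
  by apply/andP; split => //; apply/asboolP.
exists x; split => [n|l Tl]; first by case: (xP n).
pose k := pickle (pattern S' e l).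
have kE : pattern S' e l = pattern S' e (r k).
  by case: (rP k) => _ /(_ _ Tl); apply; rewrite pickleK.
near=> n.
apply: (same_pattern e_inj kE).
have [_ /(_ k.+1)] := xP n.
move=> h; apply/Lr/h.
  by near: n; exists k.+1.
by near: n; exact: Tcur.
Unshelve. all: by end_near. Qed.

End FrechetPower.

Lemma wf_recursion (W X : Type) (lt : W -> W -> Prop) (d : X)
    (step : (W -> X) -> W -> X) : well_founded lt ->
  exists f, forall a, f a = step (fun b => if `[< lt b a >] then f b else d) a.
Proof.
move=> wf.
pose F a (rec : forall b, lt b a -> X) :=
  step (fun b => if pselect (lt b a) is left h then rec b h else d) a.
exists (Fix wf _ F) => a.
rewrite Fix_eq /F; last first.
  move=> b f g fg; congr step; apply/funext => c.
  by case: pselect.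
congr step; apply/funext => b.
by case: pselect => h; [rewrite asboolT|rewrite asboolF].
Qed.

Definition strict_well_order (W : Type) (lt : W -> W -> Prop) :=
  [/\ well_founded lt, forall a b c, lt a b -> lt b c -> lt a c &
      forall a b, [\/ lt a b, a = b | lt b a]].

(** The power of the structure (A, D) modulo the Frechet filter realizes every
    consistent type over countably many parameters; this is iterated along a
    well-order with countable initial segments. The coordinates of rank a are chosen at stage a,
    all at once. The hypothesis carried through the recursion (stage) speaks of
    all finite lists of conditions that hold along F, including those that
    mention coordinates not yet chosen: for almost all n, what has been chosen
    extends to a solution. *)
Lemma frechet_power_saturation (I : choiceType) (A : Type) (C : countType)
    (D : C -> seq A -> Prop) (W : Type) (lt : W -> W -> Prop) (rho : I -> W)
    (F : set_system (I -> A)) :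
  strict_well_order lt ->
  (forall a, countable [set i | lt (rho i) a \/ rho i = a]) ->
  ProperFilter F ->
  exists x : nat -> I -> A, forall c s,
    F [set y | D c (map y s)] -> \forall n \near \oo, D c (map (x n) s).
Proof.
move=> [wf lt_trans lt_total] cW PF.
have [y0 _] := filter_ex (@filterT _ F _).
pose T : set (seq (C * seq I)) := [set l | F (satisfies D l)].
have T0 : T [::] by rewrite /T /=; apply: filterS filterT => y _ cs.
have Tcat l l' : T l -> T l' -> T (l ++ l').
  by rewrite /T /= => Fl Fl'; rewrite satisfies_cat; apply: filterI.
pose below a : set I := [set i | lt (rho i) a].
pose upto a : set I := [set i | lt (rho i) a \/ rho i = a].
pose good a (cur x : nat -> I -> A) :=
  (forall n i, below a i -> x n i = cur n i) /\
  forall l, T l -> \forall n \near \oo,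
     exists y, (forall i, upto a i -> y i = x n i) /\ satisfies D l y.
pose step (G : W -> nat -> I -> A) a : nat -> I -> A :=
  let cur n i := G (rho i) n i in
  if pselect (exists x, good a cur x) is left ex then projT1 (cid ex) else cur.
have [f fE] := wf_recursion (fun=> y0) step wf.
pose x n i := f (rho i) n i.
pose stage a := forall l, T l -> \forall n \near \oo,
  exists y, (forall i, upto a i -> y i = x n i) /\ satisfies D l y.
(* At any stage, a finite list sees only boundedly many earlier coordinates,
   so limit stages need no argument of their own. *)
have bound a (s : seq I) : (forall i, i \in s -> ~ below a i) \/
    exists2 b, lt b a & forall i, i \in s -> below a i -> upto b i.
  elim: s => [|i s IH]; first by left.
  have [ia|ia] := pselect (below a i); last first.
    case: IH => [h|[b ba h]]; [left|right; exists b => //] => j;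
      by rewrite inE => /predU1P[->//|]; exact: h.
  right; case: IH => [h|[b ba h]].
    exists (rho i) => // j; rewrite inE => /predU1P[->|/h//].
    by move=> _; right.
  case: (lt_total (rho i) b) => [ib|ib|bi].
  - exists b => // j; rewrite inE => /predU1P[->|/h]; last exact.
    by move=> _; left.
  - exists b => // j; rewrite inE => /predU1P[->|/h]; last exact.
    by move=> _; right.
  - exists (rho i) => // j; rewrite inE => /predU1P[->|js ja]; first by right.
    by left; case: (h j js ja) => jb; [exact: lt_trans bi|rewrite /= jb].
have stageP a : stage a.
  elim/(well_founded_ind wf): a => a IH.
  have before l : T l -> \forall n \near \oo,
      exists y, (forall i, below a i -> y i = x n i) /\ satisfies D l y.
    move=> Tl.
    have patch n y : satisfies D l y ->
        (forall i, i \in flatten (map snd l) -> below a i -> y i = x n i) ->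
        exists y, (forall i, below a i -> y i = x n i) /\ satisfies D l y.
      move=> ly ybelow; exists (fun i => if `[< below a i >] then x n i else y i).
      split=> [i ia|]; first by rewrite asboolT.
      apply: eq_satisfies ly => i il; case: asboolP => // ia.
      exact: ybelow.
    case: (bound a (flatten (map snd l))) => [nobelow|[b ba hb]].
      have [y ly] := filter_ex Tl.
      near=> n; apply: (patch n y) => // i il /nobelow; exact.
    have := IH b ba l Tl; apply: filterS => n [y [yx ly]].
    by apply: (patch n y) => // i il ia; apply: yx; exact: hb.
  have [x' good_x'] : exists x', good a x x'.
    by apply: extend_stage before => // [i|]; [left|exact: cW].
  suff [fx fstage] : good a x (f a).
    have fax n i : upto a i -> f a n i = x n i.
      by case=> [|<-]//; exact: fx.
    move=> l Tl; have := fstage l Tl; apply: filterS => n [y [yf ly]].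
    by exists y; split=> // i ia; rewrite yf // fax.
  have curE n i : below a i ->
      (if `[< lt (rho i) a >] then f (rho i) else fun=> y0) n i = x n i.
    by move=> ia; rewrite asboolT.
  rewrite fE /step; case: pselect => [ex|]; last first.
    case; exists x'; case: good_x' => h1 h2; split => // n i ia.
    by rewrite curE // h1.
  case: (cid ex) => z /= [h1 h2]; split => // n i ia.
  by rewrite h1 // curE.
exists x => c s Fcs.
have Tcs : T [:: (c, s)].
  by rewrite /T /=; apply: filterS Fcs => y ys cs; rewrite inE => /eqP ->.
have [s0|[b hb]] : s = [::] \/ exists b, forall i, i \in s -> upto b i.
- elim: s {Fcs Tcs} => [|i s IH]; [by left|right].
  case: IH => [->|[b hb]].
    by exists (rho i) => j; rewrite inE => /eqP ->; right.
  case: (lt_total (rho i) b) => [ib|ib|bi].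
  + by exists b => j; rewrite inE => /predU1P[->|/hb//]; left.
  + by exists b => j; rewrite inE => /predU1P[->|/hb//]; right.
  + exists (rho i) => j; rewrite inE => /predU1P[->|/hb]; first by right.
    by case=> jb; left; [exact: lt_trans bi|rewrite jb].
- by apply: nearW => n; have [y] := filter_ex Fcs; rewrite s0.
have := stageP b _ Tcs; apply: filterS => n [y [yx ly]].
have := ly (c, s); rewrite inE eqxx => /(_ isT) /=.
by have -> : map y s = map (x n) s by apply/eq_in_map => i /hb; exact: yx.
Unshelve. all: by end_near. Qed.

(** * Well-orders of type omega_1 *)

Lemma well_order_strict (W : eqType) (R : rel W) :
  well_order R -> strict_well_order (fun a b => ~~ R b a).
Proof.
move=> wo.
have least (P : W -> Prop) : (exists a, P a) ->
    exists2 a, P a & forall b, P b -> R a b.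
  move=> [a Pa]; have [|m [[Pm mR] _]] := wo [pred b | `[< P b >]].
    by exists a; rewrite inE.
  exists m; first by move: Pm; rewrite inE.
  by move=> b Pb; apply: mR; rewrite inE.
have total a b : R a b \/ R b a.
  have [|m [->|->] h] := least (fun c => c = a \/ c = b).
  - by exists a; left.
  - by left; apply: h; right.
  - by right; apply: h; left.
have antisym a b : R a b -> R b a -> a = b.
  move=> ab ba; have raa c : R c c by case: (total c c).
  have [|m [_ uniq_m]] := wo [pred c | (c == a) || (c == b)].
    by exists a; rewrite inE eqxx.
  have ma : m = a.
    apply: uniq_m; split; first by rewrite inE eqxx.
    by move=> c; rewrite inE => /orP[] /eqP ->.
  rewrite -ma; apply: uniq_m; split; first by rewrite inE eqxx orbT.
  by move=> c; rewrite inE => /orP[] /eqP ->.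
have trans a b c : R a b -> R b c -> R a c.
  move=> ab bc.
  have [|m [->|[->|->]] h] := least (fun d => d = a \/ d = b \/ d = c).
  - by exists a; left.
  - by apply: h; right; right.
  - by have -> : a = b by apply: antisym => //; apply: h; left.
  - have cb : R c b by apply: h; right; left.
    by rewrite (antisym _ _ cb bc).
split.
- move=> a; apply: contrapT => na.
  have [|m nm h] := least (fun a => ~ Acc (fun a b => ~~ R b a) a).
    by exists a.
  apply: nm; constructor => b /negP mb; apply: contrapT => nb.
  by apply: mb; apply: h.
- move=> a b c /negP ba /negP cb; apply/negP => ca.
  case: (total a b) => // ab; apply: cb; exact: trans ab.
- move=> a b; case: (boolP (R b a)) => ba; last by constructor 1.
  case: (boolP (R a b)) => ab; last by constructor 3.
  by constructor 2; exact: antisym.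
Qed.

Lemma strict_well_order_pullback (V W : Type) (lt : W -> W -> Prop)
    (g : V -> W) : injective g -> strict_well_order lt ->
  strict_well_order (fun a b => lt (g a) (g b)).
Proof.
move=> g_inj [wf lt_trans lt_total]; split.
- suff acc w : forall v, g v = w -> Acc (fun a b => lt (g a) (g b)) v.
    by move=> v; exact: acc.
  elim/(well_founded_ind wf): w => w IH v gv; constructor => u.
  by rewrite gv => /IH /(_ u erefl).
- by move=> a b c; exact: lt_trans.
- move=> a b; case: (lt_total (g a) (g b)) => [|/g_inj|].
  + by constructor 1.
  + by constructor 2.
  + by constructor 3.
Qed.

Lemma countable_preimage (V W : Type) (g : V -> W) (S : set W) :
  injective g -> countable S -> countable (g @^-1` S).
Proof.
move=> g_inj /countable_injP[e e_inj]; apply/countable_injP.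
exists (e \o g) => a b; rewrite !inE => Sa Sb /= eab.
by apply/g_inj/e_inj; rewrite ?inE.
Qed.

(** If some initial segment of an arbitrary well-order of B is uncountable, the
    least such segment has all its own initial segments countable; being
    uncountable, it has room for an injective copy of B, because the cardinality
    of B is the least uncountable one. *)
Lemma aleph1_well_order (T : choiceType) (B : set T) : card_aleph1 B ->
  exists lt : B -> B -> Prop, strict_well_order lt /\
    forall a, countable [set b | lt b a].
Proof.
move=> [Bunc Bmin].
have [R /well_order_strict] := well_ordering_principle B.
pose lt a b : Prop := ~~ R b a; rewrite -/lt => Rwo.
have [all_c|/existsNP[a0 a0unc]] :=
  pselect (forall a, countable [set b | lt b a]); first by exists lt.
have [a aunc amin] : exists2 a, ~ countable [set b | lt b a] &
    forall b, lt b a -> countable [set c | lt c b].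
  have [wf _ _] := Rwo.
  elim/(well_founded_ind wf): a0 a0unc => a IH aunc.
  have [h|/existsNP[b /not_implyP[ba bunc]]] :=
    pselect (forall b, lt b a -> countable [set c | lt c b]).
    by exists a.
  exact: IH ba bunc.
have /card_leP[f] := Bmin _ _ aunc.
pose g b : B := val (f b).
have ga b : lt (g b) a by exact: set_valP (f b).
have g_inj : injective g.
  by move=> b c /val_inj; apply: inj; rewrite inE.
exists (fun b c => lt (g b) (g c)); split.
  exact: strict_well_order_pullback.
move=> b; apply: (countable_preimage g_inj (S := [set c | lt c (g b)])).
by apply: amin; exact: ga.
Qed.

Local Open Scope ring_scope.

(** * Walks in a continuum and their linear interpolation *)

Lemma near_all_mem (I : eqType) (T : Type) (F : set_system T)
    (s : seq I) (P : I -> T -> Prop) : Filter F ->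
  (forall i, i \in s -> \forall y \near F, P i y) ->
  \forall y \near F, forall i, i \in s -> P i y.
Proof.
move=> FF; elim: s => [|i s IH] h; first exact: nearW.
near=> y => j; rewrite inE => /predU1P[->|js].
  by near: y; apply: h; rewrite mem_head.
suff : forall j, j \in s -> P j y by apply.
by near: y; apply: IH => k ks; apply: h; rewrite inE ks orbT.
Unshelve. all: by end_near. Qed.

Section Clamp.
Context {R : realType}.

Definition clamp (t : R) : R := Num.min 1 (Num.max 0 t).

Lemma clamp_ge0 t : 0 <= clamp t.
Proof. by rewrite /clamp le_min ler01 le_max lexx. Qed.

Lemma clamp_le1 t : clamp t <= 1.
Proof. by rewrite /clamp ge_min lexx. Qed.

Lemma clamp_le0 t : t <= 0 -> clamp t = 0.
Proof. by move=> t0; rewrite /clamp max_l // min_r. Qed.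

Lemma clamp_ge1 t : 1 <= t -> clamp t = 1.
Proof. by move=> t1; rewrite /clamp min_l // le_max t1 orbT. Qed.

Lemma clamp_id t : 0 <= t <= 1 -> clamp t = t.
Proof. by move=> /andP[t0 t1]; rewrite /clamp max_r // min_r. Qed.

Lemma clamp_lipschitz t u : `|clamp t - clamp u| <= `|t - u|.
Proof.
have mono (a b : R) : a <= b -> 0 <= clamp b - clamp a <= b - a.
  move=> ab; rewrite /clamp.
  by case: (leP 0 a) => a0; case: (leP 0 b) => b0;
    do ?[case: (leP 1) => ?]; lra.
case: (leP t u) => [/mono|/ltW /mono] /andP[h1 h2].
  by rewrite distrC [leRHS]distrC !ger0_norm //; exact: le_trans h2.
by rewrite !ger0_norm //; exact: le_trans h2.
Qed.

Lemma clamp_continuous : continuous clamp.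
Proof.
move=> t; apply: continuous_min; first exact: cvg_cst.
apply: continuous_max; first exact: cvg_cst.
exact: cvg_id.
Qed.

End Clamp.

Section PiecewiseLinear.
Context {R : realType} {K : Type}.

(** The walk x :: z is traversed at unit speed, resting at its ends: at time k
    the value is the value of f at the k-th vertex. To the interpolation of the
    walk from y, delayed by 1, one adds a correction that vanishes from time 1
    on; no gluing of continuous functions is needed. *)
Fixpoint piecewise_linear (f : K -> R) (x : K) (z : seq K) (t : R) : R :=
  if z is y :: z' then
    (f x - f y) * (1 - clamp t) + piecewise_linear f y z' (t - 1)
  else f x.

Lemma piecewise_linear_continuous f x z : continuous (piecewise_linear f x z).
Proof.
elim: z x => [|y z IH] x t /=; first exact: cvg_cst.
apply: cvgD.
  apply: cvgM; first exact: cvg_cst.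
  by apply: cvgB; [exact: cvg_cst|exact: clamp_continuous].
apply: (@continuous_comp R R R (fun t => t - 1) (piecewise_linear f y z));
  last exact: IH.
by apply: cvgB; [exact: cvg_id|exact: cvg_cst].
Qed.

Lemma piecewise_linear_start f x z t : t <= 0 ->
  piecewise_linear f x z t = f x.
Proof.
elim: z x t => //= y z IH x t t0.
by rewrite clamp_le0 // IH ?subr0 ?mulr1 ?subrK //; lra.
Qed.

Lemma piecewise_linear_end f x z t : (size z)%:R <= t ->
  piecewise_linear f x z t = f (last x z).
Proof.
elim: z x t => //= y z IH x t; rewrite -natr1 => zt.
have z0 : 0 <= (size z)%:R :> R by [].
rewrite clamp_ge1; last by lra.
by rewrite IH ?subrr ?mulr0 ?add0r //; lra.
Qed.

End PiecewiseLinear.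

Section Walks.
Context {R : realType} {K : topologicalType} (I : eqType) (phi : I -> K -> R).

Definition close_on (s : seq I) (eps : R) : rel K :=
  fun x y => `[< forall i, i \in s -> `|phi i x - phi i y| < eps >].

Lemma close_onC s eps x y : close_on s eps x y = close_on s eps y x.
Proof.
by apply/asboolP/asboolP => h i /h; rewrite distrC.
Qed.

Lemma piecewise_linear_close s eps x z : path (close_on s eps) x z -> 0 < eps ->
  forall t, exists w, forall i, i \in s ->
    `|piecewise_linear (phi i) x z t - phi i w| < eps.
Proof.
move=> + eps0; elim: z x => [|y z IH] x /=.
  by move=> _ t; exists x => i _; rewrite subrr normr0.
move=> /andP[/asboolP xy yz] t; case: (leP t 1) => t1.
  exists x => i si; rewrite piecewise_linear_start; last by lra.
  have -> : (phi i x - phi i y) * (1 - clamp t) + phi i y - phi i x =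
      - ((phi i x - phi i y) * clamp t) by lra.
  rewrite normrN normrM (ger0_norm (clamp_ge0 t)).
  apply: le_lt_trans (xy i si).
  by rewrite ler_piMr // clamp_le1.
have [w hw] := IH y yz (t - 1).
exists w => i si; rewrite clamp_ge1; last by lra.
by rewrite subrr mulr0 add0r; exact: hw.
Qed.

Lemma piecewise_linear_visits (x w : K) z : w \in x :: z ->
  exists2 t : R, 0 <= t <= (size z)%:R &
    forall f : K -> R, piecewise_linear f x z t = f w.
Proof.
elim: z x => [|y z IH] x /=.
  by rewrite inE => /eqP ->; exists 0; rewrite ?lexx.
rewrite inE => /predU1P[->|/IH[t t_itv tw]].
  by exists 0 => [|f]; [rewrite lexx /=|exact: (piecewise_linear_start _ _ (_ :: _))].
exists (t + 1) => [|f]; first by rewrite -natr1; lra.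
rewrite clamp_ge1; last by lra.
by rewrite subrr mulr0 add0r addrK.
Qed.

Hypothesis phi_cont : forall i, continuous (phi i).

Lemma close_on_near s eps x y : close_on s eps x y ->
  \forall y' \near y, close_on s eps x y'.
Proof.
move=> /asboolP xy.
suff : \forall y' \near y, forall i, i \in s -> `|phi i x - phi i y'| < eps.
  by apply: filterS => y' h; apply/asboolP.
apply: near_all_mem => i si.
have cont : (fun y' => `|phi i x - phi i y'|) @ y --> `|phi i x - phi i y|.
  by apply: cvg_norm; apply: cvgB; [exact: cvg_cst|exact: phi_cont].
by move/cvgr_lt: cont; apply; exact: xy.
Qed.

Lemma close_on_refl s eps x : 0 < eps -> close_on s eps x x.
Proof. by move=> eps0; apply/asboolP => i _; rewrite subrr normr0. Qed.

(** Total boundedness, by compactness in its near-covering form for the filter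
    of finite subsets. *)
Lemma close_on_net s eps : compact [set: K] -> 0 < eps ->
  exists xs : seq K, forall x, exists2 y, y \in xs & close_on s eps x y.
Proof.
move=> /compact_near_coveringP cpt eps0.
pose F : set_system (seq K) :=
  filter_from setT (fun xs : seq K => [set xs' | {subset xs <= xs'}]).
have FF : Filter F.
  apply: filter_from_filter; first by exists [::].
  move=> xs xs' _ _; exists (xs ++ xs') => // l h.
  by split=> x xl; apply: h; rewrite mem_cat xl ?orbT.
have PF : ProperFilter F.
  by apply: filter_from_proper => xs _; exists xs.
pose P (xs : seq K) x := exists2 y, y \in xs & close_on s eps x y.
have : \forall xs \near F, [set: K] `<=` P xs.
  apply: cpt => x _.
  exists ([set x' | close_on s eps x' x], [set xs | x \in xs]) => /=.
    split; last by exists [:: x] => // l; apply; rewrite mem_head.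
    have := close_on_near (close_on_refl s x eps0).
    by apply: filterS => y; rewrite /= close_onC.
  by move=> [x' xs] /= [? ?]; exists x.
by move=> /filter_ex[xs xsP]; exists xs => x; exact: xsP.
Qed.

Context (x0 : K).

(** The points that a walk from x0 can reach and come back from form a clopen
    set: a neighbour y of such an x is reached by the detour x, y, x. *)
Lemma closed_walk_through s eps x : connected [set: K] -> 0 < eps ->
  exists z, [/\ path (close_on s eps) x0 z, last x0 z = x0 & x \in x0 :: z].
Proof.
move=> conn eps0.
pose reach x := exists z1 z2, [/\ path (close_on s eps) x0 z1, last x0 z1 = x,
  path (close_on s eps) x z2 & last x z2 = x0].
have reach_close x' y' : reach x' -> close_on s eps x' y' -> reach y'.
  move=> [z1 [z2 [p1 l1 p2 l2]]] xy.
  exists (rcons z1 y'), (x' :: z2); split => //=.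
  - by rewrite rcons_path p1 l1.
  - by rewrite last_rcons.
  - by rewrite close_onC xy.
have reachT : [set x | reach x] = setT.
  apply: conn.
  - by exists x0; exists [::], [::]; split.
  - exists [set x | reach x]; last by rewrite setTI.
    rewrite openE => x' rx'.
    have := close_on_near (close_on_refl s x' eps0).
    by apply: filterS => y'; exact: reach_close.
  - exists [set x | reach x]; last by rewrite setTI.
    move=> x' /(_ _ (close_on_near (close_on_refl s x' eps0)))[y' [ry' xy']].
    by apply: reach_close ry' _; rewrite close_onC.
have [z1 [z2 [p1 l1 p2 l2]]] : reach x by have : setT x by []; rewrite -reachT.
exists (z1 ++ z2); split.
- by rewrite cat_path p1 l1.
- by rewrite last_cat l1.
- by rewrite -cat_cons mem_cat -l1 mem_last.
Qed.

Lemma closed_walk_through_all s eps (xs : seq K) :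
  connected [set: K] -> 0 < eps ->
  exists z, [/\ path (close_on s eps) x0 z, last x0 z = x0 &
    {subset xs <= x0 :: z}].
Proof.
move=> conn eps0; elim: xs => [|x xs [z [pz lz zxs]]]; first by exists [::].
have [z' [pz' lz' xz']] := closed_walk_through s x conn eps0.
exists (z ++ z'); split.
- by rewrite cat_path pz lz.
- by rewrite last_cat lz.
move=> y; rewrite inE -cat_cons mem_cat => /predU1P[->|/zxs-> //].
move: xz'; rewrite inE => /predU1P[->|->]; first by rewrite mem_head.
by rewrite orbT.
Qed.

End Walks.

(** * Sequences of loops that trace a continuum *)

(** Functions supported in [0, 1], rather than on [0, 1]: they can then be
    strung together by adding translates. *)
Definition loop (R : realType) : Type :=
  {y : R -> R | continuous y /\ forall t, t <= 0 \/ 1 <= t -> y t = 0}.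

Definition loop_fun (R : realType) (y : loop R) : R -> R := proj1_sig y.
Coercion loop_fun : loop >-> Funclass.

Lemma loop0 (R : realType) (l : loop R) t : t <= 0 \/ 1 <= t -> l t = 0.
Proof. exact: (proj2_sig l).2. Qed.

Section Loops.
Context {R : realType} {K : topologicalType} (I : choiceType).
Context (phi : I -> K -> R) (x0 : K).

(** In the coordinates listed in s, the image of the path y is at
    Hausdorff distance at most eps from the image of K. *)
Definition traces (s : seq I) (eps : R) : set (I -> loop R) :=
  [set y | (forall t, exists w, forall i, i \in s -> `|y i t - phi i w| < eps) /\
    forall w, exists2 t, 0 <= t <= 1 &
      forall i, i \in s -> `|y i t - phi i w| < eps].

Lemma sub_traces s s' (eps eps' : R) : {subset s <= s'} -> eps' <= eps ->
  traces s' eps' `<=` traces s eps.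
Proof.
move=> ss' ee' y [near_K all_K]; split.
  move=> t; have [w hw] := near_K t; exists w => i /ss' /hw h.
  exact: lt_le_trans ee'.
move=> w; have [t t01 ht] := all_K w; exists t => // i /ss' /ht h.
exact: lt_le_trans ee'.
Qed.

Hypothesis phi_cont : forall i, continuous (phi i).
Hypothesis phi0 : forall i, phi i x0 = 0.
Hypothesis K_compact : compact [set: K].
Hypothesis K_connected : connected [set: K].

Lemma traces_nonempty s eps : 0 < eps -> traces s eps !=set0.
Proof.
move=> eps0; have e20 : 0 < eps / 2 by lra.
have [xs xsP] := close_on_net phi_cont s K_compact e20.
have [z [pz lz zxs]] :=
  closed_walk_through_all phi_cont x0 s xs K_connected e20.
pose L : R := (size z).+1%:R.
have L0 : 0 < L by rewrite ltr0Sn.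
pose f i t := piecewise_linear (phi i) x0 z (L * t).
have floop i : continuous (f i) /\ forall t, t <= 0 \/ 1 <= t -> f i t = 0.
  split=> [t|t [t0|t1]].
  - apply: (@continuous_comp R R R (fun t => L * t)
      (piecewise_linear (phi i) x0 z)).
      by apply: cvgM; [exact: cvg_cst|exact: cvg_id].
    exact: piecewise_linear_continuous.
  - by rewrite /f piecewise_linear_start ?phi0 // pmulr_rle0.
  - rewrite /f piecewise_linear_end ?lz ?phi0 //.
    have : L <= L * t by rewrite ler_peMr // ltW.
    by rewrite /L -natr1; lra.
exists (fun i => exist _ (f i) (floop i) : loop R); split => [t|w] /=.
  have [w hw] := piecewise_linear_close pz e20 (L * t).
  exists w => i si; have := hw i si; rewrite /loop_fun /= /f; lra.
have [x xxs /asboolP wx] := xsP w.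
have [t /andP[t0 tz] tP] := @piecewise_linear_visits R _ _ _ _ (zxs _ xxs).
exists (t / L) => [|i si].
  rewrite divr_ge0 ?(ltW L0) //= ler_pdivrMr // mul1r.
  by rewrite /L -natr1; lra.
rewrite /loop_fun /= /f mulrC divfK ?gt_eqF // tP distrC.
by have := wx i si; lra.
Qed.

Definition traces_filter : set_system (I -> loop R) :=
  filter_from [set p : seq I * R | 0 < p.2] (fun p => traces p.1 p.2).

Lemma traces_filter_proper : ProperFilter traces_filter.
Proof.
apply: filter_from_proper; last first.
  by move=> [s eps] /= eps0; exact: traces_nonempty.
apply: filter_from_filter; first by exists ([::], 1) => /=.
move=> [s eps] [s' eps'] /= eps0 eps0'.
exists (s ++ s', Num.min eps eps') => /=; first by rewrite lt_min eps0.
move=> y ytr; split; apply: sub_traces ytr => /=.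
- by move=> i si; rewrite mem_cat si.
- by rewrite ge_min lexx.
- by move=> i si; rewrite mem_cat si orbT.
- by rewrite ge_min lexx orbT.
Qed.

Definition close_to_code (N : nat) (v : seq R) (q : seq rat) : Prop :=
  forall k, (k < size v)%N -> `|v`_k - ratr q`_k| < N.+1%:R^-1.

(** A code is a finite set of rational points together with a radius, and it
    describes the compact sets at Hausdorff distance less than the radius from
    the finite set. There are countably many codes, and they do not refer to
    K or to phi. *)
Definition decodes (c : seq (seq rat) * nat) (ys : seq (loop R)) : Prop :=
  (forall t, exists2 q, q \in c.1 &
     close_to_code c.2 [seq (y : loop R) t | y <- ys] q) /\
  (forall q, q \in c.1 -> exists2 t, 0 <= t <= 1 &
     close_to_code c.2 [seq (y : loop R) t | y <- ys] q).

Lemma close_to_code_map N (s : seq I) (g : I -> R) (c : I -> rat) :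
  close_to_code N (map g s) (map c s) <->
  forall i, i \in s -> `|g i - ratr (c i)| < N.+1%:R^-1.
Proof.
split=> [h i si|h k]; last first.
  rewrite size_map => ks.
  have i0 : I by case: (s) ks => // i.
  by rewrite !(nth_map i0) //; apply: h; exact: mem_nth.
have ks : (index i s < size s)%N by rewrite index_mem.
have := h (index i s); rewrite size_map => /(_ ks).
by rewrite !(nth_map i) // nth_index.
Qed.

(** The code is a rational approximation of a finite net of the image of K. *)
Lemma traces_code s eps : 0 < eps -> exists c,
  traces_filter [set y | decodes c (map y s)] /\
  forall y : I -> loop R, decodes c (map y s) -> traces s eps y.
Proof.
move=> eps0.
have [N Neps] : exists N : nat, N.+1%:R^-1 < eps / 2.
  have /ltr_add_invr[N] : 0 < eps / 2 by lra.
  by rewrite add0r => ?; exists N.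
set d : R := N.+1%:R^-1 in Neps.
have d0 : 0 < d by rewrite /d invr_gt0 ltr0Sn.
have d40 : 0 < d / 4 by lra.
have [xs xsP] := close_on_net phi_cont s K_compact d40.
have /choice[c cP] : forall xi : K * I, exists q : rat,
    `|phi xi.2 xi.1 - ratr q| < d / 4.
  move=> [x i] /=.
  have /rat_in_itvoo[q] : phi i x - d / 4 < phi i x + d / 4 by lra.
  by rewrite in_itv /= => /andP[? ?]; exists q; rewrite ltr_norml; lra.
pose code x := map (fun i => c (x, i)) s.
exists (map code xs, N); split.
  exists (s, d / 4) => //= y [near_K all_K]; split => /=.
    move=> t; have [w hw] := near_K t; have [x xxs /asboolP wx] := xsP w.
    exists (code x); first exact: map_f.
    rewrite -map_comp; apply/close_to_code_map => i si /=.
    have := cP (x, i); have := hw i si; have := wx i si.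
    rewrite -/d !ltr_norml /= => /andP[? ?] /andP[? ?] /andP[? ?].
    by apply/andP; split; lra.
  move=> q /mapP[x xxs ->]; have [t t01 ht] := all_K x; exists t => //.
  rewrite -map_comp; apply/close_to_code_map => i si /=.
  have := cP (x, i); have := ht i si.
  rewrite -/d !ltr_norml /= => /andP[? ?] /andP[? ?].
  by apply/andP; split; lra.
move=> y [/= near_K all_K]; split.
  move=> t; have [_ /mapP[x xxs ->]] := near_K t.
  rewrite -map_comp => /close_to_code_map hx; exists x => i si.
  have := cP (x, i); have := hx i si.
  rewrite /= -/d !ltr_norml /= => /andP[? ?] /andP[? ?].
  by apply/andP; split; lra.
move=> w; have [x xxs /asboolP wx] := xsP w.
have [|t t01] := all_K (code x); first exact: map_f.
rewrite -map_comp => /close_to_code_map hx; exists t => // i si.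
have := cP (x, i); have := hx i si; have := wx i si.
rewrite /= -/d !ltr_norml /= => /andP[? ?] /andP[? ?] /andP[? ?].
by apply/andP; split; lra.
Qed.

(** The trace conditions themselves depend on K and on uncountably many
    coordinates; it is through the codes that saturation applies. *)
Lemma exists_tracing_sequence (W : Type) (lt : W -> W -> Prop) (rho : I -> W) :
  strict_well_order lt ->
  (forall a, countable [set i | lt (rho i) a \/ rho i = a]) ->
  exists y : nat -> I -> loop R, forall s (eps : R), 0 < eps ->
    \forall n \near \oo, traces s eps (y n).
Proof.
move=> lt_wo rho_cnt.
have [y yP] := frechet_power_saturation decodes lt_wo rho_cnt traces_filter_proper.
exists y => s eps eps0; have [c [Fc ctr]] := traces_code s eps0.
by have := yP c s Fc; apply: filterS => n; exact: ctr.
Qed.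

End Loops.

Section Concatenation.
Context {R : realType} (y : nat -> loop R).

(** The n-th loop is run through during the time interval [n, n + 1]. *)
Definition concat_loops (t : R) : R := y (Num.truncn t) (t - (Num.truncn t)%:R).

Lemma concat_loopsE n t : 0 <= t <= 1 -> concat_loops (n%:R + t) = y n t.
Proof.
move=> /andP[t0 t1]; rewrite /concat_loops.
have [->|t_ne1] := eqVneq t 1.
  rewrite natr1 natrK subrr !loop0 //; [by right|by left].
rewrite (@truncn_def _ _ n); first by rewrite addrC addKr.
by rewrite lerDl t0 -natr1 ltrD2l lt_neqAle t_ne1.
Qed.

Lemma concat_loops_sum N t : t < N%:R -> concat_loops t = \sum_(k < N) y k (t - k%:R).
Proof.
move=> tN; case: (leP 0 t) => t0; last first.
  rewrite /concat_loops loop0; last first.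
    by left; have : 0 <= (Num.truncn t)%:R :> R by []; lra.
  rewrite big1 // => k _; apply: loop0; left.
  by have : 0 <= k%:R :> R by []; lra.
have /andP[mt tm] := truncn_itv t0; set m := Num.truncn t in mt tm *.
have mN : (m < N)%N by rewrite -(ltr_nat R); exact: le_lt_trans tN.
rewrite (bigD1 (Ordinal mN)) //= big1 ?addr0 // => k km.
have {km} : val k != m by rewrite -val_eqE in km.
rewrite neq_ltn => /orP[km|mk]; apply: loop0.
  by right; move: km; rewrite -(ler_nat R) -natr1 => km; lra.
by left; move: mk; rewrite -(ler_nat R) => mk; lra.
Qed.

Lemma concat_loops_continuous : continuous concat_loops.
Proof.
move=> t; pose N := (Num.truncn t).+1.
have tN : t < N%:R by exact: truncnS_gt.
rewrite /continuous_at (concat_loops_sum tN).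
have nearE : {near t, (fun u : R => \sum_(k < N) y k (u - k%:R)) =1 concat_loops}.
  by near=> u; rewrite -concat_loops_sum //; near: u; exact: lt_nbhsl.
apply: cvg_trans; first exact: near_eq_cvg nearE.
suff : continuous (fun u : R => \sum_(k < N) y k (u - k%:R)) by apply.
apply: continuous_big => [|k _ u]; first exact: add_continuous.
apply: (@continuous_comp R R R (fun u : R => u - k%:R) (y k)).
  by apply: cvgB; [exact: cvg_id|exact: cvg_cst].
exact: (proj2_sig (y k)).1.
Unshelve. all: by end_near. Qed.

End Concatenation.

(** * The unit cube and induced topologies *)

Section UnitInterval.
Context {R : realType}.

Lemma clamp_unit (t : R) : clamp t \in (`[0, 1]%classic : set R).
Proof. by rewrite inE /= in_itv /= clamp_ge0 clamp_le1. Qed.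

Definition to_unit (t : R) : unit_itv R := exist _ (clamp t) (clamp_unit t).

End UnitInterval.

Section InducedTopologies.

Lemma continuous_set_type (X T : topologicalType) (A : set T) (f : X -> A) :
  continuous (fun x => val (f x)) -> continuous f.
Proof.
move=> /continuousP cf; apply/continuousP => _ [V oV <-].
exact: cf.
Qed.

Lemma continuous_val (T : topologicalType) (A : set T) :
  continuous (fun x : A => val x).
Proof. exact: (@initial_continuous A T set_val). Qed.

Lemma continuous_into_prod (X : topologicalType) (I : Type)
    (T : I -> topologicalType) (f : X -> prod_topology T) :
  (forall i, continuous (fun x => f x i)) -> continuous f.
Proof.
move=> cf x; apply/cvg_sup => i U [_ [[V oV <-]] Vfx VU].
apply: filterS VU _.
by apply: (cf i x V); apply: open_nbhs_nbhs.
Qed.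

Lemma continuous_coord (I : Type) (T : I -> topologicalType) (i : I) :
  continuous (fun f : prod_topology T => f i).
Proof. exact: (@proj_continuous {classic I} T i). Qed.

Definition bundle_continuous (X Y : topologicalType) (f : X -> Y)
    (cf : continuous f) : continuousType X Y :=
  HB.pack f (isContinuous.Build X Y f cf).

End InducedTopologies.

Section CompactUnit.
Context {R : realType}.

Lemma to_unit_continuous : continuous (@to_unit R).
Proof. apply: continuous_set_type. exact: clamp_continuous. Qed.

Lemma compact_set_type (T : topologicalType) (A B : set T) :
  compact B -> B `<=` A -> compact [set x : A | B (val x)].
Proof.
move=> cB BA F PF FB.
have PG : ProperFilter (val @ F) by exact: fmap_proper_filter.
have [|x [Bx clx]] := cB (val @ F) PG; first exact: FB.
exists (exist _ x (mem_set (BA x Bx))); split => // C U FC.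
move=> [_ [[V oV <-]] Vx VU].
have FvC : (val @ F) (val @` C) by apply: (@filterS _ F _ C) FC => c Cc; exists c.
have [_ [[c Cc <-] Vc]] := clx _ _ FvC (open_nbhs_nbhs (conj oV Vx)).
by exists c; split => //; exact: VU.
Qed.

Lemma hausdorff_set_type (T : topologicalType) (A : set T) :
  hausdorff_space T -> hausdorff_space A.
Proof.
move=> hT x y clxy; apply: val_inj; apply: hT => U V Ux Vy.
have [z [Uz Vz]] := clxy _ _ (continuous_val Ux) (continuous_val Vy).
by exists (val z).
Qed.

Lemma unit_itv_compact : compact [set: unit_itv R].
Proof.
have := compact_set_type (@segment_compact R 0 1) (@subset_refl _ _).
by congr compact; apply/seteqP; split => // u _; exact: set_valP.
Qed.

Lemma unit_itv_hausdorff : hausdorff_space (unit_itv R).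
Proof. by apply: hausdorff_set_type; exact: Rhausdorff. Qed.

Lemma unit_cube_compact (J : Type) :
  compact [set: prod_topology (fun _ : J => unit_itv R)].
Proof.
have := @tychonoff {classic J} (fun=> unit_itv R) (fun=> setT)
  (fun=> unit_itv_compact).
by congr compact; apply/seteqP; split.
Qed.

Lemma unit_cube_hausdorff (J : Type) :
  hausdorff_space (prod_topology (fun _ : J => unit_itv R)).
Proof.
exact: (@hausdorff_product {classic J} (fun=> unit_itv R)
  (fun=> unit_itv_hausdorff)).
Qed.

End CompactUnit.

Section Solutions.
Context {R : realType} {T : topologicalType} {I : Type}.

Lemma near_value (f : T -> R) (x : T) (eps : R) : continuous f -> 0 < eps ->
  nbhs x (fun y => `|f y - f x| < eps).
Proof.
move=> cf eps0; have /cvgr_dist_lt/(_ _ eps0) := cf x.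
by apply: filterS => y; rewrite distrC.
Qed.

Lemma cluster_solution (psi : I -> T -> R) (z : I -> R) (F : set_system T) p :
  (forall i, continuous (psi i)) ->
  (forall i (eps : R), 0 < eps -> F [set x | `|psi i x - z i| < eps]) ->
  cluster F p -> forall i, psi i p = z i.
Proof.
move=> cpsi Fz clp i; apply/eqP; rewrite -subr_eq0 -normr_eq0.
apply: contrapT => /negP ne0.
have d0 : 0 < `|psi i p - z i| / 2 by rewrite divr_gt0 // lt_neqAle eq_sym ne0 /=.
have [x [/= h1 h2]] := clp _ _ (Fz i _ d0) (near_value p (cpsi i) d0).
have := ler_distD (psi i x) (psi i p) (z i); rewrite (distrC (psi i p) (psi i x)); lra.
Qed.

End Solutions.

(** * Values at the points of a Cech-Stone remainder *)

Section Remainder.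
Context {R : realType} {X : topologicalType} (r : X -> R).
Hypothesis r_cont : continuous r.
Hypothesis r_proper : forall T, compact [set x | r x <= T].

Lemma stone_cech_ev_continuous : continuous (@stone_cech_ev R X).
Proof.
by apply: continuous_into_prod => f; exact: (@cts_fun _ _ f).
Qed.

(** The part of X where r <= T has compact, hence closed, image in the
    Cech-Stone compactification, so it does not accumulate at the remainder. *)
Lemma remainder_far (p : stone_cech_remainder R X) T :
  closure (@stone_cech_ev R X @` [set x | T <= r x]) (val p).
Proof.
have [p_cl p_nev] := set_valP p.
have : closure (@stone_cech_ev R X @` [set x | r x <= T] `|`
    @stone_cech_ev R X @` [set x | T <= r x]) (val p).
  apply: closureS p_cl => _ [x _ <-].
  by case: (leP (r x) T) => xT; [left|right]; exists x => //=; exact: ltW.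
rewrite closureU => -[|//] p_near; exfalso; apply: p_nev.
suff : closed (@stone_cech_ev R X @` [set x | r x <= T]).
  by move=> /closure_id ballE; move: p_near; rewrite -ballE => -[x _ <-]; exists x.
apply: compact_closed; first exact: unit_cube_hausdorff.
apply: (@continuous_compact X (stone_cech_cube R X)); last exact: r_proper.
exact/continuous_subspaceT/stone_cech_ev_continuous.
Qed.

Lemma unit_coord_continuous (h : continuousType X (unit_itv R)) :
  continuous (fun q : stone_cech_cube R X => val (q h)).
Proof.
move=> q; apply: (@continuous_comp _ _ _ (fun q : stone_cech_cube R X => q h)
  (fun u : unit_itv R => val u)); first exact: continuous_coord.
exact: continuous_val.
Qed.

Lemma near_unit_coord (q0 : stone_cech_cube R X)
    (h : continuousType X (unit_itv R)) (eps : R) : 0 < eps ->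
  nbhs q0 (fun q => `|val (q h) - val (q0 h)| < eps).
Proof.
move=> eps0; apply: (@near_value _ (stone_cech_cube R X)) => //.
exact: unit_coord_continuous.
Qed.

(** The tuples of values that the extensions of the functions g i take at a
    point of the remainder are exactly the limits of their values along r
    tending to infinity. For the existence, a cluster point p in the cube of
    the points w with r w >= T and g i w near z i is not in X: the function
    min(1, max(0, r w - r x)), which is 0 at x, has the value 1 at p. *)
Lemma remainder_values (I : choiceType)
    (g : I -> continuousType X (unit_itv R)) (z : I -> unit_itv R) :
  (exists p : stone_cech_remainder R X, forall i, val p (g i) = z i) <->
  forall (s : seq I) (eps T : R), 0 < eps -> exists2 w, T <= r w &
    forall i, i \in s -> `|val (g i w) - val (z i)| < eps.
Proof.
split=> [[p pz] s eps T eps0|approx].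
  have near_p : nbhs (val p : stone_cech_cube R X)
      (fun q => forall i, i \in s -> `|val (q (g i)) - val (z i)| < eps).
    apply: (@near_all_mem I (stone_cech_cube R X)
      (nbhs (val p : stone_cech_cube R X)) s
      (fun i q => `|val (q (g i)) - val (z i)| < eps)) => i _.
    by rewrite -(pz i); exact: near_unit_coord.
  by have [_ [[w Tw <-] wP]] := @remainder_far p T _ near_p; exists w.
pose ev := @stone_cech_ev R X.
pose A (k : seq I * R * R) : set X := [set w | k.2 <= r w /\
  forall i, i \in k.1.1 -> `|val (g i w) - val (z i)| < k.1.2].
pose F : set_system (stone_cech_cube R X) :=
  filter_from [set k | 0 < k.1.2] (fun k => ev @` A k).
have PF : ProperFilter F.
  apply: filter_from_proper; last first.
    move=> [[s eps] T] /= eps0; have [w Tw wP] := approx s eps T eps0.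
    by exists (ev w), w.
  apply: filter_from_filter; first by exists ([::], 1, 0) => /=.
  move=> [[s eps] T] [[s' eps'] T'] /= eps0 eps0'.
  exists (s ++ s', Num.min eps eps', Num.max T T') => /=.
    by rewrite lt_min eps0.
  move=> q [w []] /=; rewrite ge_max => /andP[Tw Tw'] wP <-.
  split; exists w => //; split => // i si /=.
    have := wP i; rewrite mem_cat si => /(_ isT).
    by rewrite lt_min => /andP[].
  have := wP i; rewrite mem_cat si orbT => /(_ isT).
  by rewrite lt_min => /andP[].
have [p [_ clp]] := unit_cube_compact PF filterT.
have p_z i : val (p (g i)) = val (z i).
  move: i; apply: (@cluster_solution R (stone_cech_cube R X) I
    (fun i q => val (q (g i))) (fun i => val (z i)) F p) => // i.
    exact: unit_coord_continuous.
  move=> eps eps0; exists ([:: i], eps, 0) => //= _ [w [/= _ wP] <-].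
  by apply: wP; rewrite mem_head.
have p_rem : p \in @stone_cech R X `\` range ev.
  rewrite inE; split.
    move=> U pU; have [|q [[w _ <-] qU]] := clp (ev @` A ([::], 1, 0)) U _ pU.
      by exists ([::], 1, 0) => /=.
    by exists (ev w); split => //; exists w.
  move=> [x _ xp].
  have h_cont : continuous (fun w => to_unit (r w - r x)).
    move=> w; apply: (@continuous_comp _ _ _ (fun w => r w - r x) (@to_unit R)).
      by apply: cvgB; [exact: r_cont|exact: cvg_cst].
    exact: to_unit_continuous.
  pose h := bundle_continuous h_cont.
  have near_p := near_unit_coord p h ltr01.
  have [|q [[w [/= wx _] <-]]] := clp (ev @` A ([::], 1, r x + 1)) _ _ near_p.
    by exists ([::], 1, r x + 1) => /=.
  rewrite -xp /= /ev /stone_cech_ev /=.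
  rewrite subrr (clamp_le0 (lexx 0)) clamp_ge1; last by lra.
  by rewrite subr0 normr1 ltxx.
exists (exist _ p p_rem) => i.
exact/val_inj/p_z.
Qed.

End Remainder.

(** * Maps from a remainder onto the half-line remainder and onto continua *)

Lemma half_line_proper (R : realType) (T : R) :
  compact [set x : half_line R | val x <= T].
Proof.
have sub : `[0, T]%classic `<=` (`[0, +oo[%classic : set R).
  by move=> x /=; rewrite !in_itv /= andbT => /andP[].
have := compact_set_type (@segment_compact R 0 T) sub.
congr compact; apply/seteqP; split => x /=; rewrite in_itv /=.
  by case/andP.
by have := set_valP x; rewrite /= in_itv /= andbT => -> ->.
Qed.

Lemma half_line_ge0 (R : realType) (x : half_line R) : 0 <= val x.
Proof. by have := set_valP x; rewrite /= in_itv /= andbT. Qed.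

Section RemainderMaps.
Context {R : realType} {X : topologicalType} (r : X -> R).
Hypothesis r_cont : continuous r.
Hypothesis r_proper : forall T, compact [set x | r x <= T].
Hypothesis r_surj : forall t, 0 <= t -> exists x, r x = t.

Lemma remainder_coord_continuous (h : continuousType X (unit_itv R)) :
  continuous (fun p : stone_cech_remainder R X => val p h).
Proof.
move=> p; apply: (@continuous_comp _ (stone_cech_cube R X) _
  (fun p : stone_cech_remainder R X => val p)
  (fun q : stone_cech_cube R X => q h)); first exact: continuous_val.
exact: continuous_coord.
Qed.

(** r, viewed as a map into the half line, extends to the remainders. A
    family of values is taken at a point of X* by the functions h o r exactly
    when it is taken at a point of H* by the functions h. *)
Lemma remainder_onto_half_line : (forall x, 0 <= r x) ->
  maps_onto (stone_cech_remainder R X) (stone_cech_remainder R (half_line R)).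
Proof.
move=> r_ge0.
pose H := half_line R; pose J : choiceType := {classic continuousType H (unit_itv R)}.
have r_itv x : r x \in (`[0, +oo[%classic : set R).
  by rewrite inE /= in_itv /= r_ge0.
pose rho x : H := exist _ (r x) (r_itv x).
have rho_cont : continuous rho by exact: continuous_set_type.
have comp_cont (h : continuousType H (unit_itv R)) : continuous (h \o rho).
  by move=> x; apply: continuous_comp; [exact: rho_cont|exact: cts_fun].
pose g (h : J) : continuousType X (unit_itv R) := bundle_continuous (comp_cont h).
have same_values (z : J -> unit_itv R) :
    (exists p : stone_cech_remainder R X, forall h, val p (g h) = z h) <->
    (exists q : stone_cech_remainder R H, forall h : J, val q h = z h).
  have valuesX := remainder_values r_cont r_proper g z.
  have valuesH := remainder_values (@continuous_val _ _) (@half_line_proper R)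
    (fun h : J => h : continuousType H (unit_itv R)) z.
  split=> [/valuesX approx|/valuesH approx].
    apply/valuesH => s eps T eps0; have [w Tw wP] := approx s eps T eps0.
    by exists (rho w).
  apply/valuesX => s eps T eps0; have [u Tu uP] := approx s eps T eps0.
  have [w wu] := r_surj (half_line_ge0 u).
  have rho_w : rho w = u by exact: val_inj.
  by exists w => [|i si]; [rewrite wu|rewrite /= rho_w; exact: uP].
have /choice[f fP] (p : stone_cech_remainder R X) :
    exists q : stone_cech_remainder R H, forall h : J, val q h = val p (g h).
  by apply/same_values; exists p.
exists f; split.
  apply: continuous_set_type; apply: continuous_into_prod => h.
  have -> : (fun p => val (f p) h) = (fun p => val p (g h)).
    by apply/funext => p; exact: fP.
  exact: remainder_coord_continuous.
apply/seteqP; split => // q _.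
have [p pq] : exists p : stone_cech_remainder R X, forall h, val p (g h) = val q h.
  by apply/same_values; exists q.
exists p => //; apply: val_inj; apply: functional_extensionality_dep => h.
by rewrite -pq; exact: fP.
Qed.

Section Onto.
Context {K : topologicalType} (I : choiceType) (psi : I -> K -> R).
Hypothesis psi_cont : forall i, continuous (psi i).
Hypothesis psi_unit : forall i x, 0 <= psi i x <= 1.
Hypothesis psi_inj : forall x y, (forall i, psi i x = psi i y) -> x = y.
Hypothesis K_compact : compact [set: K].
Hypothesis K_connected : connected [set: K].

Lemma compact_solution (z : I -> R) :
  (forall (s : seq I) (eps : R), 0 < eps ->
    exists x, forall i, i \in s -> `|psi i x - z i| < eps) ->
  exists x, forall i, psi i x = z i.
Proof.
move=> approx.
pose A (k : seq I * R) : set K :=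
  [set x | forall i, i \in k.1 -> `|psi i x - z i| < k.2].
pose F : set_system K := filter_from [set k | 0 < k.2] A.
have PF : ProperFilter F.
  apply: filter_from_proper; last by move=> [s eps] /= /(approx s).
  apply: filter_from_filter; first by exists ([::], 1) => /=.
  move=> [s eps] [s' eps'] /= eps0 eps0'.
  exists (s ++ s', Num.min eps eps') => /=; first by rewrite lt_min eps0.
  move=> x xP; split => i si; have := xP i; rewrite /= mem_cat si ?orbT;
    by move=> /(_ isT); rewrite lt_min => /andP[].
have [x [_ clx]] := K_compact PF filterT.
exists x; apply: cluster_solution clx => // i eps eps0.
by exists ([:: i], eps) => // y; apply; rewrite /= mem_head.
Qed.

(** The concatenated loops f i are coordinates of a path in a cube whose
    cluster set at infinity is the embedded copy of K under psi; composed with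
    r and extended to the remainder they give the coordinates of a map onto
    that copy. *)
Lemma remainder_onto_traced (x0 : K) (W : Type) (lt : W -> W -> Prop)
    (rho : I -> W) :
  strict_well_order lt ->
  (forall a, countable [set i | lt (rho i) a \/ rho i = a]) ->
  maps_onto (stone_cech_remainder R X) K.
Proof.
move=> lt_wo rho_cnt.
pose phi i x := psi i x - psi i x0.
have phi_cont i : continuous (phi i).
  by move=> x; apply: cvgB; [exact: psi_cont|exact: cvg_cst].
have phi0 i : phi i x0 = 0 by rewrite /phi subrr.
have [y yP] :=
  exists_tracing_sequence phi_cont phi0 K_compact K_connected lt_wo rho_cnt.
pose f i := concat_loops (fun n => y n i).
(* The base point x0 was moved to the origin to make the loops close up; G moves
   it back, and clamping brings the slight overshoot back into [0, 1]. *)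
pose G i x := to_unit (psi i x0 + f i (r x)).
have G_cont i : continuous (G i).
  move=> x; apply: (@continuous_comp _ _ _ (fun x => psi i x0 + f i (r x))
    (@to_unit R)); last exact: to_unit_continuous.
  apply: cvgD; first exact: cvg_cst.
  by apply: (@continuous_comp _ _ _ r (f i)); [exact: r_cont|exact: concat_loops_continuous].
pose g i := bundle_continuous (G_cont i).
have G_near i w x (eps : R) : `|f i (r w) - phi i x| < eps ->
    `|val (g i w) - psi i x| < eps.
  move=> fx; rewrite -(clamp_id (psi_unit i x)); apply: le_lt_trans fx.
  apply: le_trans (clamp_lipschitz _ _) _.
  by rewrite /phi opprB addrA (addrC (psi i x0)) addrAC.
have traced s (eps : R) : 0 < eps -> exists N, forall n, (N <= n)%N ->
    traces phi s eps (y n).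
  by move=> eps0; have [N _ NP] := yP s eps eps0; exists N.
have values (p : stone_cech_remainder R X) :
    exists x, forall i, val (val p (g i)) = psi i x.
  suff [x xP] : exists x, forall i, psi i x = val (val p (g i)) by exists x.
  apply: compact_solution => s eps eps0.
  have e20 : 0 < eps / 2 by lra.
  have [N NP] := traced s _ e20.
  have [approx _] := remainder_values r_cont r_proper g (fun i => val p (g i)).
  have [|w Nw wP] := approx _ s (eps / 2) N%:R e20; first by exists p.
  have rw0 : 0 <= r w by apply: le_trans Nw.
  have Nm : (N <= Num.truncn (r w))%N by rewrite truncn_ge_nat.
  have [near_K _] := NP _ Nm.
  have [x xP] := near_K (r w - (Num.truncn (r w))%:R).
  exists x => i si.
  have := wP i si; have /G_near := xP i si.
  rewrite !ltr_norml => /andP[? ?] /andP[? ?]; apply/andP; split; lra.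
have attained x : exists p : stone_cech_remainder R X,
    forall i, val (val p (g i)) = psi i x.
  have [_ exP] := remainder_values r_cont r_proper g (fun i => to_unit (psi i x)).
  have [|p pP] := exP.
    move=> s eps T eps0.
    have [N NP] := traced s _ eps0.
    pose n := maxn N (Num.truncn T).+1.
    have [_ all_K] := NP n (leq_maxl _ _).
    have [t t01 tP] := all_K x.
    have Tn : T <= n%:R.
      apply/ltW/(lt_le_trans (truncnS_gt T)).
      by rewrite ler_nat leq_maxr.
    have /andP[t0 _] := t01.
    have [w wE] : exists w, r w = n%:R + t by apply: r_surj; rewrite addr_ge0.
    exists w => [|i si]; first by rewrite wE; lra.
    rewrite [val (to_unit _)](clamp_id (psi_unit i x)).
    by apply: G_near; rewrite wE /f concat_loopsE //; exact: tP.
  by exists p => i; rewrite pP; exact: clamp_id.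
have /choice[F FP] := values.
exists F; split; last first.
  apply/seteqP; split => // x _; have [p pP] := attained x.
  by exists p => //; apply: psi_inj => i; rewrite -FP.
pose cube := prod_topology (fun _ : I => unit_itv R).
pose e x : cube := fun i => to_unit (psi i x).
have e_cont : continuous e.
  apply: continuous_into_prod => i x.
  apply: (@continuous_comp _ _ _ (psi i) (@to_unit R)); first exact: psi_cont.
  exact: to_unit_continuous.
pose v (p : stone_cech_remainder R X) : cube := fun i => val p (g i).
have v_cont : continuous v.
  by apply: continuous_into_prod => i; exact: remainder_coord_continuous.
have eF p : e (F p) = v p.
  apply: functional_extensionality_dep => i; apply: val_inj.
  by rewrite [LHS](clamp_id (psi_unit i (F p))) FP.
have e_inj x x' : e x = e x' -> x = x'.
  move=> exx'; apply: psi_inj => i.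
  rewrite -(clamp_id (psi_unit i x)) -(clamp_id (psi_unit i x')).
  exact: (congr1 (fun q : cube => val (q i)) exx').
(* F is continuous because e is a closed embedding and e \o F = v is
   continuous. *)
apply/continuous_closedP => C C_closed.
have -> : F @^-1` C = v @^-1` (e @` C).
  apply/seteqP; split => p /=; first by exists (F p) => //; exact: eF.
  by move=> [x Cx]; rewrite -eF => /e_inj <-.
move/continuous_closedP: v_cont; apply.
apply: compact_closed; first exact: unit_cube_hausdorff.
apply: (@continuous_compact K cube); first exact: continuous_subspaceT.
exact: subclosed_compact K_compact _.
Qed.

End Onto.

(** Urysohn functions of pairs of basic open sets separate points, so that no
    more than weight many coordinates are needed. *)
Lemma basis_separation (K : topologicalType) (B : set (set K)) :
  basis B -> compact [set: K] -> hausdorff_space K ->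
  forall x y : K, x <> y -> exists U V : B,
    @Urysohn K R (closure (val U)) (~` val V) x <>
    @Urysohn K R (closure (val U)) (~` val V) y.
Proof.
move=> [B_open B_nbhs] cK hK x y xy.
have Tx : nbhs x [set: K] by exact: filterT.
have reg := compact_regular hK cK Tx.
have cl_y : closed [set y].
  by apply: accessible_closed_set1; exact: hausdorff_accessible.
have : nbhs x (~` [set y]).
  by apply: open_nbhs_nbhs; split => //; exact: closed_openC.
move=> /B_nbhs[V [BV Vx] Vy].
have : nbhs x V by apply: open_nbhs_nbhs; split => //; exact: B_open.
move=> /reg[N xN clNV].
have [U [BU Ux] UN] := B_nbhs x _ xN.
exists (exist _ U (mem_set BU)), (exist _ V (mem_set BV)) => /=.
have sep : uniform_separator (closure U) (~` V).
  have /(@normal_separatorP R) := compact_normal hK cK; apply.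
  - exact: closed_closure.
  - by apply: open_closedC; exact: B_open.
  - by apply/disjoints_subset; rewrite setCK; apply: subset_trans clNV;
      exact: closureS.
have -> : @Urysohn K R (closure U) (~` V) x = 0.
  by apply: (@Urysohn_sub0 K R _ _ sep); exists x => //; exact: subset_closure.
have -> : @Urysohn K R (closure U) (~` V) y = 1.
  by apply: (@Urysohn_sub1 K R _ _ sep); exists y => // /Vy; exact.
by apply/eqP; rewrite eq_sym oner_eq0.
Qed.

(** Ranking a pair by the larger of its entries leaves countably many pairs
    below each rank, without comparing the cardinality of W * W to that
    of W. *)
Lemma pairs_rank (W : eqType) (lt : W -> W -> Prop) :
  strict_well_order lt -> (forall a, countable [set b | lt b a]) ->
  exists rho : W * W -> W,
    forall a, countable [set i | lt (rho i) a \/ rho i = a].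
Proof.
move=> [_ lt_trans lt_total] cnt.
pose rho (i : W * W) := if `[< lt i.1 i.2 >] then i.2 else i.1.
exists rho => a; pose S := [set b | lt b a] `|` [set a].
have S_cnt : countable S.
  suff : countable (\bigcup_(b in [set: bool]) if b then [set b | lt b a] else [set a]).
    apply: sub_countable; apply: subset_card_le => b [ba|->].
      by exists true.
    by exists false.
  apply: bigcup_countable => // b _; case: b => //; exact: countable1.
apply: sub_countable (countableX S_cnt S_cnt); apply: subset_card_le.
move=> [b c]; rewrite /rho /=; case: asboolP => bc.
  move=> [ca|ca]; split => /=.
  - by left; exact: lt_trans ca.
  - by left.
  - by left; rewrite -ca.
  - by right.
have cb : lt c b \/ c = b.
  by case: (lt_total b c) => [//|->|]; [right|left].
move=> [ba|ba]; split => /=.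
- by left.
- by left; case: cb => [cb|->]; [exact: lt_trans ba|exact: ba].
- by right.
- by case: cb => cb; [left; rewrite -ba|right; rewrite cb].
Qed.

Lemma remainder_onto_continuum (K : topologicalType) :
  continuum K -> weight_aleph1 K -> maps_onto (stone_cech_remainder R X) K.
Proof.
move=> [[x0 _] cK connK hK] [B [B_basis _ B_aleph1]].
have [lt [lt_wo lt_cnt]] := aleph1_well_order B_aleph1.
have [rho rho_cnt] := pairs_rank lt_wo lt_cnt.
pose psi (i : B * B) : K -> R :=
  Urysohn (closure (val i.1)) (~` val i.2).
apply: (@remainder_onto_traced K _ psi _ _ _ cK connK x0 _ lt rho) => //.
- by move=> i; exact: Urysohn_continuous.
- move=> i x; have : range (psi i) (psi i x) by exists x.
  by move=> /Urysohn_range; rewrite /= in_itv.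
- move=> x y same; apply: contrapT => xy.
  have [U [V]] := basis_separation B_basis cK hK xy.
  by apply; exact: (same (U, V)).
Qed.

End RemainderMaps.

(** * Euclidean space *)

Section Euclidean.
Context (R : realType) (n : nat).

Definition euclidean_norm (v : euclidean_space R n) : R := `|(v : 'rV[R]_n)|.

Lemma euclidean_norm_continuous : continuous euclidean_norm.
Proof. exact: (@norm_continuous R 'rV[R]_n). Qed.

Lemma euclidean_norm_proper T : compact [set v | euclidean_norm v <= T].
Proof.
apply: bounded_closed_compact.
  exists T; split; first exact: num_real.
  by move=> M TM v /= vT; exact: (le_trans vT (ltW TM)).
apply: (@closed_comp _ _ euclidean_norm [set x | x <= T]).
  by move=> v _; exact: euclidean_norm_continuous.
exact: closed_le.
Qed.

Lemma euclidean_norm_surj t : (1 <= n)%N -> 0 <= t ->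
  exists v, euclidean_norm v = t.
Proof.
move=> n1 t0; pose u : 'rV[R]_n := const_mx 1.
have u0 : `|u| != 0.
  rewrite normr_eq0; apply/eqP => /rowP/(_ (Ordinal n1)).
  by rewrite !mxE => /eqP; rewrite oner_eq0.
exists ((t / `|u|) *: u).
by rewrite /euclidean_norm normrZ normrM normfV normr_id divfK // ger0_norm.
Qed.

End Euclidean.

Theorem mainTheorem9 (R : realType) (n : nat) (hn : (1 <= n)%N) :
  maps_onto (stone_cech_remainder R (euclidean_space R n))
            (stone_cech_remainder R (half_line R)) /\
  (forall K : topologicalType, continuum K -> weight_aleph1 K ->
     maps_onto (stone_cech_remainder R (euclidean_space R n)) K).
Proof.
have cont := @euclidean_norm_continuous R n.
have proper := @euclidean_norm_proper R n.
have surj t := @euclidean_norm_surj R n t hn.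
split.
  by apply: (remainder_onto_half_line cont proper surj) => v; exact: normr_ge0.
by move=> K; exact: (remainder_onto_continuum cont proper surj).
Qed.
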